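(* There exists a subspace of $\beta\omega$ containing $\omega$ whose square is not countably compact and that is $n$-cascade countably compact for every $n\in\omega$.
   Context: $\beta\omega$ is the Stone–Čech compactification of the discrete space $\omega$, whose points are identified with the ultrafilters on $\omega$ (each $n\in\omega$ being identified with the principal ultrafilter at $n$). For infinite $M\subseteq\omega$ and $n\in\omega$, $[M]^n$ is the set of $n$-element subsets of $M$ (so $[M]^0=\{\emptyset\}$). If $p$ is a free ultrafilter on $\omega$, $A\in p$ and $(x_m:m\in A)$ is a family in a topological space $X$, then $x\in X$ is a $p$-limit of it if $\{m\in A:x_m\in U\}\in p$ for every neighborhood $U$ of $x$. Cascade limits: let $X$ be a topological space, $p$ a free ultrafilter on $\omega$ with $M\in p$, and $f$ a function into $X$ whose domain contains $[M]^n$. Recursively on $n$, $x\in X$ is an $[M]^n$-cascade $p$-limit point of $f$ if: for $n=0$, $f(\emptyset)=x$; for $n>0$, there exist $A\in p$ with $A\subseteq M$ and a family $(x_m:m\in A)$ in $X$ such that for every $m\in A$, $x_m$ is an $[M\setminus(m+1)]^{n-1}$-cascade $p$-limit point of $f_m:[M\setminus(m+1)]^{n-1}\to X$, $f_m(s)=f(\{m\}\cup s)$, and $x$ is a $p$-limit of $(x_m:m\in A)$. (Here $m+1=\{0,\dots,m\}$.) $X$ is $n$-cascade countably compact if for every $f:[\omega]^n\to X$ there is a free ultrafilter $p$ on $\omega$ such that $f$ has an $[\omega]^n$-cascade $p$-limit point in $X$. A space is countably compact if every sequence $(x_n:n\in\omega)$ in it has an accumulation point, i.e. a point each of whose neighborhoods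 contains $x_n$ for infinitely many $n$. *)

(* Defs.v *)
From HB Require Import structures.
From mathcomp Require Import all_boot finmap all_classical topology.

Set Implicit Arguments.
Unset Strict Implicit.
Unset Printing Implicit Defensive.

Local Open Scope classical_set_scope.

(* The Stone-Cech compactification of discrete nat, as the space of ultrafilters
   with the sets {u | A \in u} as a base; n is identified with the principal
   ultrafilter [beta_embed n]. *)
Record betaomega := Betaomega {
  ultra_of :> set nat -> Prop ;
  ultra_ofP : UltraFilter ultra_of }.

HB.instance Definition _ := gen_eqMixin betaomega.
HB.instance Definition _ := gen_choiceMixin betaomega.

Definition beta_clopen (A : set nat) : set betaomega := [set u : betaomega | u A].

Lemma beta_clopen_cover : \bigcup_(A in [set: set nat]) beta_clopen A = setT.
Proof.
rewrite -subTset => u _; exists setT => //.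
by have uU := ultra_ofP u; exact: filterT.
Qed.

Lemma beta_clopen_join (A B : set nat) (u : betaomega) :
  [set: set nat] A -> [set: set nat] B -> beta_clopen A u -> beta_clopen B u ->
  exists C, [/\ [set: set nat] C, beta_clopen C u &
                beta_clopen C `<=` beta_clopen A `&` beta_clopen B].
Proof.
move=> _ _ uA uB; exists (A `&` B); split=> //.
  by have uU := ultra_ofP u; exact: filterI.
move=> v vAB; have vU := ultra_ofP v.
by split; apply: filterS vAB => n [].
Qed.

HB.instance Definition _ :=
  isBaseTopological.Build betaomega beta_clopen_cover beta_clopen_join.

Lemma nbhs_betaomega (u : betaomega) (U : set betaomega) :
  nbhs u U <-> exists2 A : set nat, u A & beta_clopen A `<=` U.
Proof.
rewrite nbhsE; split.
  move=> [V [[D _ <-] [A DA uA]] VU].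
  by exists A => // v vA; apply: VU; exists A.
move=> [A uA AU]; exists (beta_clopen A) => //; split=> //.
by exists [set A] => //; rewrite bigcup_set1.
Qed.

Definition beta_embed (n : nat) : betaomega :=
  Betaomega (principal_filter_ultra n).

Definition free_ultrafilter (p : set_system nat) : Prop :=
  UltraFilter p /\ \bigcap_(A in p) A = set0.

(* The family is only relevant on A; its values elsewhere are ignored. *)
Definition is_plimit (X : topologicalType) (p : set_system nat) (A : set nat)
    (y : nat -> X) (x : X) : Prop :=
  forall U : set X, nbhs x U -> p [set m | A m /\ U (y m)].

(* [f] is total, but only its values on the n-element subsets of [M] matter.
   `I_m.+1 is {0, ..., m}. *)
Fixpoint cascade_plimit (X : topologicalType) (p : set_system nat) (n : nat)
    (M : set nat) (f : {fset nat} -> X) (x : X) : Prop :=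
  match n with
  | 0 => f fset0 = x
  | k.+1 => exists (A : set nat) (y : nat -> X),
      [/\ p A,
          A `<=` M,
          forall m, A m ->
            cascade_plimit p k (M `\` `I_m.+1) (fun s => f (m |` s)%fset) (y m)
        & is_plimit p A y x]
  end.

(* Quantifying over all [f : {fset nat} -> X] amounts to quantifying over the
   functions from the n-element subsets of nat to X: such a function extends
   to {fset nat}, as it takes at least one value. *)
Definition cascade_countably_compact (n : nat) (X : topologicalType) : Prop :=
  forall f : {fset nat} -> X,
    exists2 p : set_system nat, free_ultrafilter p &
      exists x : X, cascade_plimit p n [set: nat] f x.

Definition countably_compact (X : topologicalType) : Prop :=
  forall u : nat -> X, exists x : X,
    forall U : set X, nbhs x U -> infinite_set [set n | U (u n)].

(* Main.v *)
Require Import Defs.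
From HB Require Import structures.
From mathcomp Require Import all_boot finmap all_classical topology.

Set Implicit Arguments.
Unset Strict Implicit.
Unset Printing Implicit Defensive.

Local Open Scope classical_set_scope.

(** Fix a free ultrafilter [p]. A [p]-limit [r] of a sequence of ultrafilters
is called admissible here when [p] lies Rudin-Keisler below [r]. Close the
even numbers under admissible [p]-limits to get a set [P] ([hull]); every free
member of [P] is then above [p]. Close the odd numbers under admissible
[q]-limits to get [Q], with [q] chosen below no member of [P]. The space is
[X = P U Q].

Why [q] exists. Members of [P] are named by real numbers ([coded] describes a
well-founded tree of limits), so only continuum many ultrafilters lie below
some member of [P]. An independent family of continuum many sets diagonalizes
against all of them ([exists_avoiding], [exists_not_below]).

Why the square fails. If [(r, r')] were an accumulation point of the sequence
[(2n, 2n+1)], then [r] would be free and in [P], [r'] would be free and in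
[Q], and [r'] would be the image of [r] under the successor. So [q] would be
below [r'], hence below [r].

Why cascades converge. Given [f : [omega]^n -> X], Ramsey's theorem gives an
infinite [M] such that [f] maps [[M]^n] into one of [P] and [Q], say [P].
The difficulty is that an arbitrary [p]-limit of points of [P] need not be
admissible, and hence need not lie in [P]. It is resolved by [exists_rigid]:
[M] has an infinite subset [H] such that for every free ultrafilter containing
[H], each limit occurring in the cascade of [f] either is the value taken by
most of the points it is a limit of, or is admissible for that ultrafilter.
Transporting [p] by an
enumeration of [H] produces an ultrafilter that contains [H] and has the same
admissible limits as [p], so the whole cascade stays in [P].

The proof of [exists_rigid] is by induction on [n] and diagonalization
([fusion]); only the outermost limit [x], of points [x_m], is new at each step.
If some infinite set admits no further separation, then ultrafilter Ramsey
([ultra_ramsey2]) shows that [x_m = x] for most [m]. Otherwise fusion produces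
[H] and sets [B_m] such that [B_m] is not in [x_m] but is in [x_k] for all later
[k] of [H]. The map sending a number to the first [m] whose [B_m] omits it then
carries [x] to the ultrafilter along which the limit is taken. *)

(** * Ultrafilters on the natural numbers *)

#[local] Instance betaomega_ultra (u : betaomega) : UltraFilter (ultra_of u) :=
  ultra_ofP u.
#[local] Instance betaomega_filter (u : betaomega) : Filter (ultra_of u).
Proof. by case: (ultra_ofP u) => -[]. Qed.
#[local] Instance betaomega_proper (u : betaomega) : ProperFilter (ultra_of u).
Proof. by case: (ultra_ofP u). Qed.

(** Ultrafilters are maximal, so one inclusion suffices for equality. *)
Lemma betaomega_subP (u v : betaomega) :
  (forall B : set nat, u B -> v B) -> u = v.
Proof.
case: u v => [u uU] [v vU] /= uv.
have E : v = u by apply: max_filter.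
by subst v; rewrite (Prop_irrelevance uU vU).
Qed.

Lemma ultraC (u : betaomega) (B : set nat) : u (~` B) <-> ~ u B.
Proof.
split=> [uC uB|nuB]; first by have [x []] := filter_ex (filterI uC uB).
by case: (in_ultra_setVsetC B (ultra_ofP u)).
Qed.

(** For an ultrafilter this is freeness: a bounded member would have a
singleton member ([nonprincipal_free]). *)
Definition free (p : betaomega) := forall k, p [set m | k < m].

Lemma free_free_ultrafilter (p : betaomega) : free p -> free_ultrafilter p.
Proof.
move=> fp; split; first exact: ultra_ofP.
by rewrite -subset0 => k /(_ _ (fp k)); rewrite /= ltnn.
Qed.

Lemma nonprincipal_free (p : betaomega) :
  (forall n, p <> beta_embed n) -> free p.
Proof.
move=> np k; elim: k => [|k IH].
  have /ultraC : ~ p [set 0].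
    move=> p0; apply: (np 0); symmetry; apply: betaomega_subP => B B0.
    exact: filterS p0.
  by apply: filterS => -[/(_ erefl)|m].
have /ultraC pk : ~ p [set k.+1].
  move=> p0; apply: (np k.+1); symmetry; apply: betaomega_subP => B B0.
  exact: filterS p0.
apply: filterS (filterI IH pk) => m /= [km mk].
by rewrite ltn_neqAle km andbT; apply/eqP => e; apply: mk.
Qed.

(** * Push-forwards and limits of ultrafilters *)

Lemma ultraP (F : set_system nat) : F setT ->
  (forall A B, F A -> F B -> F (A `&` B)) ->
  (forall A B, A `<=` B -> F A -> F B) ->
  (forall A, F (~` A) <-> ~ F A) -> UltraFilter F.
Proof.
move=> FT FI FS FC.
have FF : ProperFilter F.
  split; last by split.
  by move=> F0; apply: (FC setT).1 FT; rewrite setCT.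
split=> // G PG FG; apply/seteqP; split=> // A GA.
apply: contrapT => /FC/FG GC.
by have [x []] := filter_ex (filterI GA GC).
Qed.

Lemma push_ultra (h : nat -> nat) (p : betaomega) :
  UltraFilter [set B | p (h @^-1` B)].
Proof.
apply: ultraP => /= [|A B pA pB|A B AB|A]; first exact: filterT.
- exact: filterI pA pB.
- by apply: filterS => k; apply: AB.
- exact: ultraC.
Qed.

Definition push h p : betaomega := Betaomega (push_ultra h p).

Lemma plim_ultra (p : betaomega) (y : nat -> betaomega) :
  UltraFilter [set B | p [set m | y m B]].
Proof.
apply: ultraP => /= [|A B pA pB|A B AB|A].
- by apply: filterE => m; exact: filterT.
- by apply: filterS (filterI pA pB) => m [/= yA yB]; exact: filterI.
- by apply: filterS => m; apply: filterS.
- rewrite -(ultraC p); split; apply: filterS => m /=; first by move/ultraC.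
  by move=> nA; apply/ultraC.
Qed.

Definition plim p y : betaomega := Betaomega (plim_ultra p y).

Lemma eq_plim (p : betaomega) (A : set nat) y z : p A ->
  (forall m, A m -> y m = z m) -> plim p y = plim p z.
Proof.
move=> pA yz; apply: betaomega_subP => B /= pB.
by apply: filterS (filterI pA pB) => m [/yz /= <-].
Qed.

(** The Rudin-Keisler preorder. *)
Definition rk_le (p r : betaomega) := exists h, push h r = p.

(** * Iterated limits *)

(** The cascade limit of [f] in the compact space of all ultrafilters, where
every limit exists. Nothing forces the numbers joined to [s] to increase,
since for free [p] almost all of them exceed those already chosen. *)
Fixpoint itlim (p : betaomega) n (f : {fset nat} -> betaomega) : betaomega :=
  if n is k.+1 then plim p (fun m => itlim p k (fun s => f (m |` s)%fset))
  else f fset0.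

(** The iterated quantifier: for [p]-most [m1], for [p]-most [m2], and so on,
[phi] holds of the set of all of them. It turns statements on membership in
an iterated limit into statements on the values of [f] ([itlimE]). *)
Fixpoint for_most (p : betaomega) n (phi : {fset nat} -> Prop) : Prop :=
  if n is k.+1 then p [set m | for_most p k (fun s => phi (m |` s)%fset)]
  else phi fset0.

Lemma itlimE p n f (B : set nat) :
  itlim p n f B = for_most p n (fun s => f s B).
Proof.
elim: n f => [//|n IH] f /=; congr (ultra_of p _).
by apply/funext => m; exact: IH.
Qed.

(** The quantifier of an ultrafilter commutes with negation, hence so do its
iterates. *)
Lemma for_most_not (p : betaomega) n phi :
  for_most p n (fun s => ~ phi s) <-> ~ for_most p n phi.
Proof.
elim: n phi => [//|n IH] phi /=; rewrite -ultraC.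
by split; apply: filterS => m /IH.
Qed.

Lemma for_most_eq (p : betaomega) n phi psi :
  (forall s, phi s <-> psi s) -> for_most p n phi -> for_most p n psi.
Proof.
elim: n phi psi => [|n IH] phi psi e /=; first by move/e.
by apply: filterS => m /=; apply: IH => s.
Qed.

Definition subsets n (H : set nat) : set {fset nat} :=
  [set s | #|` s| = n /\ forall i, i \in s -> H i].

Definition above m (H : set nat) : set nat := H `&` [set k | m < k].

Lemma subsets0 H : subsets 0 H fset0.
Proof. by split; rewrite ?cardfs0 // => i; rewrite inE. Qed.

Lemma subsetsS n (H G : set nat) : H `<=` G -> subsets n H `<=` subsets n G.
Proof. by move=> HG s [cs sH]; split=> // i /sH/HG. Qed.

Lemma subsets_cons n (H : set nat) m s : H m ->
  subsets n (above m H) s -> subsets n.+1 H (m |` s)%fset.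
Proof.
move=> Hm [cs sH]; split.
  rewrite cardfsU1 cs; case: (boolP (m \in s)) => // /sH [_ /=].
  by rewrite ltnn.
by move=> i; rewrite !inE => /orP[/eqP->//|/sH[]].
Qed.

Lemma for_most_subsets (p : betaomega) n (H : set nat) phi : free p -> p H ->
  (forall s, subsets n H s -> phi s) -> for_most p n phi.
Proof.
move=> fp; elim: n H phi => [|n IH] H phi pH Hphi /=.
  by apply: Hphi; exact: subsets0.
apply: filterS (pH) => m Hm.
  apply: (IH (above m H)); first exact: filterI pH (fp m).
by move=> s ms; apply: Hphi; apply: subsets_cons.
Qed.

(** * Ramsey theory for an ultrafilter *)

Definition unbounded (H : set nat) := forall k, exists2 m, H m & k < m.

(** The invariant of the ultrafilter proof of Ramsey's theorem: every subset
of the finite set [F] that is small enough is still completed to a solution of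
[phi] by most tuples. *)
Definition spread (p : betaomega) n (phi : {fset nat} -> Prop)
    (F : {fset nat}) :=
  forall s j, (s `<=` F)%fset -> #|` s| + j = n ->
    for_most p j (fun t => phi (s `|` t)%fset).

Lemma spread0 (p : betaomega) n phi : for_most p n phi -> spread p n phi fset0.
Proof.
move=> pn s j; rewrite fsubset0 => /eqP->; rewrite cardfs0 add0n => ->.
by apply: for_most_eq pn => t; rewrite fset0U.
Qed.

(** Each of the finitely many [s] in [F] still has most continuations, and the
first element of a continuation ranges over a set in [p]; the intersection of
these sets is in [p]. *)
Lemma spreadS (p : betaomega) n phi F :
  spread p n phi F -> p [set m | spread p n phi (m |` F)%fset].
Proof.
move=> sF.
have pI : p (\bigcap_(s in [set` fpowerset F])
    [set m | forall j, #|` s| + j.+1 = n ->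
       for_most p j (fun t => phi (s `|` (m |` t))%fset)]).
  apply: filter_bigI => s; rewrite fpowersetE => sub.
  have [ltn|nlt] := boolP (#|` s| < n); last first.
    apply: filterE => m j e; case/negP: nlt.
    by rewrite -e -addSnnS leq_addr.
  have e : #|` s| + (n - #|` s|.+1).+1 = n by rewrite -addSnnS subnKC.
  have /= := sF s _ sub e; apply: filterS => m /= om j ej.
  suff -> : j = n - #|` s|.+1 by [].
  by rewrite -ej -addSnnS addKn.
apply: filterS pI => m /= mI s j sub ej.
have [ms|ms] := boolP (m \in s); last first.
  apply: sF ej; apply/fsubsetP => i si.
  move/fsubsetP: sub => /(_ i si); rewrite !inE => /orP[/eqP e|//].
  by rewrite -e si in ms.
have sD : (s `\ m)%fset \in fpowerset F by rewrite fpowersetE fsubDset.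
have := mI _ sD j.
rewrite -addSnnS.
have -> : #|` (s `\ m)%fset|.+1 = #|` s| by rewrite (cardfsD1 m s) ms.
move=> /(_ ej); apply: for_most_eq => t.
by rewrite fsetUA (fsetUC (s `\ m)%fset) fsetD1K.
Qed.

Lemma spread_subsets (p : betaomega) n phi F s : spread p n phi F ->
  (s `<=` F)%fset -> #|` s| = n -> phi s.
Proof.
move=> sF sub cs; have := sF s 0 sub; rewrite addn0 => /(_ cs) /=.
by rewrite fsetU0.
Qed.

(** A property of finite sets that survives adding most elements holds along an
increasing sequence of finite sets, whose union is the required set. *)
Lemma grow (p : betaomega) (H : set nat) (Gamma : {fset nat} -> Prop) :
  free p -> p H -> Gamma fset0 ->
  (forall F, Gamma F -> p [set m | Gamma (m |` F)%fset]) ->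
  exists H' : set nat, [/\ unbounded H', H' `<=` H &
    forall s : {fset nat}, (forall i, i \in s -> H' i) ->
      exists2 F, (s `<=` F)%fset & Gamma F].
Proof.
move=> fp pH G0 GS.
have next kF : exists m, Gamma kF.2 ->
    [/\ H m, kF.1 < m & Gamma (m |` kF.2)%fset].
  have [GF|nG] := pselect (Gamma kF.2); last by exists 0.
  have [m [[Hm km] Gm]] := filter_ex (filterI (filterI pH (fp kF.1)) (GS _ GF)).
  by exists m.
have [nxt nxtP] := choice next.
pose fix seqF k := if k is j.+1 then (nxt (j, seqF j) |` seqF j)%fset else fset0.
have GF k : Gamma (seqF k) by elim: k => //= k /(nxtP (k, _))[].
have mono j k : (seqF j `<=` seqF (j + k)%N)%fset.
  elim: k => [|k IH]; first by rewrite addn0.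
  by rewrite addnS /=; apply: fsubset_trans IH (fsubsetUr _ _).
exists [set m | exists k, m \in seqF k]; split.
- move=> k; exists (nxt (k, seqF k)); first by exists k.+1; rewrite /= !inE eqxx.
  by have [] := nxtP (k, seqF k) (GF k).
- move=> m [k]; elim: k => [|k IH] /=; first by rewrite inE.
  by rewrite !inE => /orP[/eqP->|//]; have [] := nxtP (k, seqF k) (GF k).
- move=> s sH; suff [k sk] : exists k, (s `<=` seqF k)%fset by exists (seqF k).
  elim/fset1U_rect: s sH => [_|m s _ IH sH]; first by exists 0; rewrite fsub0set.
  have [|k sk] := IH; first by move=> i si; apply: sH; rewrite inE si orbT.
  have [j mj] := sH m (fset1U1 _ _).
  exists (k + j); rewrite fsubUset fsub1set.
  rewrite (fsubset_trans sk (mono _ _)) andbT.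
  by rewrite addnC; move/fsubsetP: (mono j k); apply.
Qed.

(** Two properties of possibly different arities are treated at once, because
the set found for the first need not belong to [p], so that the second could
not be handled afterwards. *)
Lemma ultra_ramsey2 (p : betaomega) (H : set nat) n1 n2 phi1 phi2 :
  free p -> p H -> for_most p n1 phi1 -> for_most p n2 phi2 ->
  exists H' : set nat, [/\ unbounded H', H' `<=` H,
    forall s, subsets n1 H' s -> phi1 s & forall s, subsets n2 H' s -> phi2 s].
Proof.
move=> fp pH o1 o2.
have [||H' [uH' H'H sH']] :=
  @grow p H (fun F => spread p n1 phi1 F /\ spread p n2 phi2 F) fp pH.
- by split; apply: spread0.
- by move=> F [/spreadS s1 /spreadS s2]; exact: filterI s1 s2.
exists H'; split=> // s [cs /sH'[F sF [s1 s2]]].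
- exact: spread_subsets s1 sF cs.
- exact: spread_subsets s2 sF cs.
Qed.

(** Shrinking repeatedly, [M = H_0 >= H_1 >= ...], with [m_k] taken from [H_k]
and [D m_k H_{k+1}]: the set of all [m_k] has its part above [m_k] inside
[H_{k+1}]. *)
Lemma fusion (D : nat -> set nat -> Prop) (M : set nat) : unbounded M ->
  (forall m H H', H' `<=` H -> D m H -> D m H') ->
  (forall H, H `<=` M -> unbounded H ->
     exists m H', [/\ H m, H' `<=` H, unbounded H' & D m H']) ->
  exists H, [/\ H `<=` M, unbounded H & forall m, H m -> D m (above m H)].
Proof.
move=> uM Dher Dex.
have next (H : set nat) : exists mH : nat * set nat, H `<=` M -> unbounded H ->
    [/\ H mH.1, mH.2 `<=` above mH.1 H, unbounded mH.2 & D mH.1 mH.2].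
  have [HM|nHM] := pselect (H `<=` M); last by exists (0, setT).
  have [uH|nuH] := pselect (unbounded H); last by exists (0, setT).
  have [m [H' [Hm H'H uH' DH']]] := Dex H HM uH.
  exists (m, above m H') => _ _; split=> //=.
  - by move=> k [/H'H].
  - move=> k; have [i Hi] := uH' (maxn m k).
    by rewrite gtn_max => /andP[mi ki]; exists i.
  - by apply: Dher DH' => k [].
have [nxt nxtP] := choice next.
pose fix Hs k := if k is j.+1 then (nxt (Hs j)).2 else M.
pose ms k := (nxt (Hs k)).1.
have inv k : Hs k `<=` M /\ unbounded (Hs k).
  elim: k => [|k [HM uH]] /=; first by split.
  have [_ sub uH' _] := nxtP _ HM uH.
  by split=> // i /sub[/HM].
have msP k : [/\ Hs k (ms k), Hs k.+1 `<=` above (ms k) (Hs k) &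
    D (ms k) (Hs k.+1)].
  by have [HM uH] := inv k; have [] := nxtP _ HM uH.
have mono j k : Hs (j + k) `<=` Hs j.
  elim: k => [|k IH]; first by rewrite addn0.
  by rewrite addnS => i; have [_ sub _] := msP (j + k) => /sub[/IH].
have ltms j k : j < k -> ms j < ms k.
  move=> jk; have [Hk _ _] := msP k; have [_ sub _] := msP j.
  have : Hs j.+1 (ms k) by apply: (mono _ (k - j.+1)); rewrite subnKC.
  by move=> /sub[].
exists [set m | exists k, m = ms k]; split.
- by move=> _ [k ->]; have [Hk _ _] := msP k; exact: (inv k).1.
- move=> k; exists (ms k.+1); first by exists k.+1.
  elim: k => [|k IH]; last exact: leq_ltn_trans IH (ltms _ _ (ltnSn _)).
  exact: leq_ltn_trans (leq0n _) (ltms 0 1 (ltnSn _)).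
- move=> _ [k ->]; have [_ _] := msP k; apply: Dher => _ [[j ->] /= kj].
  have {}kj : k < j.
    rewrite ltnNge; apply/negP => jk; move: kj; apply/negP.
    rewrite -leqNgt; move: jk; rewrite leq_eqVlt => /orP[/eqP->//|/ltms].
    exact: ltnW.
  have [Hj _ _] := msP j; have := mono k.+1 (j - k.+1).
  by rewrite subnKC // => /(_ _ Hj).
Qed.

(** * Rigid sets for iterated limits *)

(** The two alternatives are the two ways in which a limit can be seen to stay in
a set that is closed under admissible limits and contains the points
converging to it. Like [itlim], the recursion visits all nodes of the cascade. *)
Fixpoint rigid (p : betaomega) n (H : set nat) (f : {fset nat} -> betaomega) :=
  if n is k.+1 then
    (forall m, H m -> rigid p k (above m H) (fun s => f (m |` s)%fset)) /\
    (p [set m | itlim p k (fun s => f (m |` s)%fset) = itlim p k.+1 f] \/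
     rk_le p (itlim p k.+1 f))
  else True.

Lemma rigidS p n (H H' : set nat) f :
  H' `<=` H -> rigid p n H f -> rigid p n H' f.
Proof.
elim: n H H' f => [//|n IH] H H' f H'H [Hm Hp]; split=> // m H'm.
by apply: IH (Hm m (H'H m H'm)) => k [/H'H].
Qed.

(** One step of the fusion that makes the outermost limit admissible. The set [B]
does not depend on [p], since [H] is built before the ultrafilter that is to
contain it. *)
Definition separates (f : {fset nat} -> betaomega) n m (H B : set nat) :=
  forall p, free p -> p H ->
    ~ itlim p n (fun s => f (m |` s)%fset) B /\
    forall k, H k -> itlim p n (fun s => f (k |` s)%fset) B.

(** Let [x_m] be the first-level limits. The first index [j] of [H] with
[k] outside [B_j] is [m] for [x_m]-most [k], since [x_m] omits [B_m] and
contains [B_j] for [j < m] in [H]. So the map [k |-> j] sends [x_m] to the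
principal ultrafilter at [m], and the [p]-limit of the [x_m] to the [p]-limit
of the principal ultrafilters, which is [p]. *)
Lemma rk_le_of_separated f n (H : set nat) (p : betaomega) :
  (forall m, H m -> exists B, separates f n m (above m H) B) ->
  free p -> p H -> rk_le p (itlim p n.+1 f).
Proof.
move=> sepH fp pH.
have exB m : exists B, H m -> separates f n m (above m H) B.
  by have [/sepH[B ?]|] := pselect (H m); [exists B|exists setT].
have [B BP] := choice exB.
pose first k m := [/\ H m, ~ B m k & forall j, j < m -> H j -> B j k].
have first_uniq k m m' : first k m -> first k m' -> m = m'.
  move=> [Hm nm am] [Hm' nm' am'].
  by case: (ltngtP m m') => [/am'/(_ Hm)/nm|/am/(_ Hm')/nm'|].
have exh k : exists m, forall m', first k m' -> m' = m.
  have [[m fm]|nf] := pselect (exists m, first k m).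
    by exists m => m' fm'; exact: first_uniq fm' fm.
  by exists 0 => m' fm'; case: nf; exists m'.
have [h hP] := choice exh.
exists h; apply/esym/betaomega_subP => A pA /=.
apply: filterS (filterI pA pH) => m [Am Hm] /=.
have am j : H j -> p (above j H) by move=> _; exact: filterI pH (fp j).
set x := itlim p n _.
have xm : x (~` B m).
  by apply/ultraC; have [] := BP m Hm p fp (am m Hm).
have xj : x (\bigcap_(j in [set` [fset j | j in iota 0 m]%fset])
    [set k | H j -> B j k]).
  apply: filter_bigI => j; rewrite !inE mem_iota => /= jm.
  have [Hj|nHj] := pselect (H j); last by apply: filterE => k /nHj.
  have [_ /(_ m)] := BP j Hj p fp (am j Hj).
  move=> Bm; have xB : x (B j) by apply: Bm; split.
  by apply: filterS xB => k Bk _.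
apply: filterS (filterI xm xj) => k [nBk Bk] /=.
rewrite -(hP k m) //; split=> // j jm; apply: Bk => /=.
by rewrite !inE mem_iota.
Qed.

(** If most first-level limits [x_m] differ from the full limit [x], take one
of them, and a set [B] in [x] but not in [x_m]. Both facts are statements on
[p]-most tuples, so they hold for all tuples from some infinite [H'], and
therefore for every free ultrafilter containing [H']: [B] separates. *)
Lemma cst_of_unseparated f n (H : set nat) (p : betaomega) :
  (forall m H', H m -> H' `<=` H -> unbounded H' ->
     ~ exists B, separates f n m H' B) ->
  free p -> p H ->
  p [set m | itlim p n (fun s => f (m |` s)%fset) = itlim p n.+1 f].
Proof.
move=> nsep fp pH; apply: contrapT => /ultraC pC.
have [m [nm Hm]] := filter_ex (filterI pC pH).
have [B [xB xmB]] : exists B, itlim p n.+1 f B /\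
    ~ itlim p n (fun s => f (m |` s)%fset) B.
  apply: contrapT => nB; apply: nm; apply/esym/betaomega_subP => B xB.
  by apply: contrapT => xmB; apply: nB; exists B.
move: xB xmB; rewrite !itlimE -for_most_not => xB xmB.
have [H' [uH' H'H fB fmB]] := ultra_ramsey2 fp pH xB xmB.
apply: (nsep m H' Hm H'H uH'); exists B => q fq qH'; split.
  by rewrite itlimE -for_most_not; exact: for_most_subsets qH' fmB.
move=> k H'k; rewrite itlimE.
apply: (@for_most_subsets q n (above k H')) => //.
  exact: filterI qH' (fq k).
by move=> s ks; apply: fB; exact: subsets_cons.
Qed.

(** A first fusion makes all the sub-cascades rigid. For the outermost limit,
either separation is possible below every infinite set and a second fusion
applies, or it fails below some infinite set. *)
Lemma exists_rigid n f (M : set nat) : unbounded M ->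
  exists H : set nat, [/\ H `<=` M, unbounded H &
    forall p, free p -> p H -> rigid p n H f].
Proof.
elim: n f M => [|n IH] f M uM; first by exists M; split.
pose D1 m (H : set nat) := forall p, free p -> p H ->
  rigid p n H (fun s => f (m |` s)%fset).
have [||H1 [HM uH1 rig]] := @fusion D1 M uM.
- move=> m H H' H'H DH p fp pH'; apply: (rigidS H'H).
  by apply: DH => //; exact: filterS pH'.
- move=> H HM uH; have [m Hm _] := uH 0.
  have [H' [H'H uH' DH']] := IH (fun s => f (m |` s)%fset) H uH.
  by exists m, H'; split.
have step H : H `<=` H1 ->
    (forall p, free p -> p H ->
       p [set m | itlim p n (fun s => f (m |` s)%fset) = itlim p n.+1 f] \/
       rk_le p (itlim p n.+1 f)) ->
    forall p, free p -> p H -> rigid p n.+1 H f.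
  move=> HH1 top p fp pH; split; last exact: top.
  move=> m Hm; apply: (@rigidS _ _ (above m H1)); first by move=> k [/HH1].
  apply: (rig m (HH1 m Hm)) => //.
  by apply: filterS (filterI pH (fp m)) => k [/HH1].
have [dense|/existsNP[H /not_implyP[HH1 /not_implyP[uH nsep]]]] :=
  pselect (forall H, H `<=` H1 -> unbounded H -> exists m H',
      [/\ H m, H' `<=` H, unbounded H' & exists B, separates f n m H' B]).
- have [|H [HH1 uH sepH]] := fusion uH1 _ dense.
    move=> m H H' H'H [B sep]; exists B => p fp pH'.
    have [|nB Bk] := sep p fp; first exact: filterS pH'.
    by split=> // k /H'H/Bk.
  exists H; split=> //; first by move=> k /HH1/HM.
  by apply: step => // p fp pH; right; exact: rk_le_of_separated fp pH.
- exists H; split=> //; first by move=> k /HH1/HM.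
  apply: step => // p fp pH; left; apply: cst_of_unseparated fp pH.
  by move=> m H' Hm H'H uH' sep; apply: nsep; exists m, H'.
Qed.

(** * An ultrafilter avoiding continuum many others *)

(** The sets [cell x], for [x : T -> V], are independent: an element is a pair
of a finite set [d] of arguments and a finite list of patterns on [d], and it
belongs to [cell x] when the restriction of [x] to [d] is listed; a [d] that
tells finitely many functions apart realizes every finite combination. Let [q]
contain [cell x] exactly when the ultrafilter coded by [x] does not. *)
Lemma exists_avoiding (T V : countType) (C : (T -> V) -> betaomega -> Prop) :
  (forall x r r', C x r -> C x r' -> r = r') ->
  exists q : betaomega, forall x r, C x r -> q <> r.
Proof.
move=> Cfun.
pose cell (x : T -> V) : set nat :=
  [set k : nat | exists2 dF : seq T * seq (seq V),
     choice.pickle dF = k & map x dF.1 \in dF.2].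
pose keep x := `[< ~ exists2 r, C x r & ultra_of r (cell x) >].
pose bs x := if keep x then cell x else ~` cell x.
pose F : set_system nat := [set B | exists l : seq (T -> V),
  forall k, (forall x, x \in l -> bs x k) -> B k].
have FF : Filter F.
  split=> [|A B [l lA] [l' lB]|A B AB [l lA]]; first by exists nil.
    exists (l ++ l') => k kl; split; [apply: lA|apply: lB] => x xl;
      by apply: kl; rewrite mem_cat xl ?orbT.
  by exists l => k /lA/AB.
have PF : ProperFilter F.
  split=> // -[l lF].
  have sep (xy : (T -> V) * (T -> V)) : exists d : seq T,
      map xy.1 d = map xy.2 d -> xy.1 = xy.2.
    have [e|/existsNP[t nt]] := pselect (forall t, xy.1 t = xy.2 t).
      by exists nil => _; apply/funext.
    by exists [:: t] => -[].
  have [d dP] := choice sep.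
  pose D := flatten [seq d xy | xy <- allpairs pair l l].
  have DP x y : x \in l -> y \in l -> map x D = map y D -> x = y.
    move=> xl yl /eq_in_map e; apply: (dP (x, y)); apply/eq_in_map => t td.
    apply: e; apply/flattenP; exists (d (x, y)) => //; apply: map_f.
    by apply/allpairsP; exists (x, y).
  apply: (lF (choice.pickle (D, [seq map x D | x <- l & keep x]))) => x xl.
  rewrite /bs; case: ifPn => kx.
    exists (D, [seq map x D | x <- l & keep x]) => //.
    by apply/mapP; exists x => //; rewrite mem_filter kx.
  move=> [_ /(pcan_inj choice.pickleK)-> /mapP[y]].
  rewrite mem_filter => /andP[ky yl] /(DP _ _ xl yl) e.
  by rewrite e ky in kx.
have [q [qU Fq]] := ultraFilterLemma PF.
exists (Betaomega qU) => x r Cx e.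
have {}Fq : ultra_of r (bs x).
  by rewrite -e; apply: Fq; exists [:: x] => k; apply; rewrite mem_head.
move: Fq; rewrite /bs; case: ifPn => /asboolP.
  by move=> nC rx; apply: nC; exists r.
by move=> /contrapT[r' /(Cfun _ _ _ Cx)<- rx] /ultraC; apply.
Qed.

(** Diagonalizing against the principal ultrafilters suffices. *)
Lemma exists_free : exists p : betaomega, free p.
Proof.
have [|p pP] := @exists_avoiding unit nat (fun x r => r = beta_embed (x tt)).
  by move=> x r r' -> ->.
by exists p; apply: nonprincipal_free => n; apply: (pP (fun=> n)).
Qed.

(** * Hulls under admissible limits *)

(** [c] labels the nodes of a tree of finite sequences: a node with a number is
a leaf standing for the principal ultrafilter there, and any other node stands
for an admissible [p]-limit of its children with index in some [A] in [p].
The code is carried along to bound the number of ultrafilters obtained. *)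
Inductive coded (p : betaomega) (S : set nat) :
    (seq nat -> option nat) -> betaomega -> Prop :=
| coded_nat c n : c [::] = Some n -> S n -> coded p S c (beta_embed n)
| coded_lim c A y : c [::] = None -> ultra_of p A ->
    (forall m, A m -> coded p S (fun s => c (m :: s)) (y m)) ->
    rk_le p (plim p y) -> coded p S c (plim p y).

Definition hull p S : set betaomega := [set r | exists c, coded p S c r].

(** The sets [A] in two derivations may differ, but the children agree on their
intersection, which is in [p]. *)
Lemma coded_inj p S c r r' : coded p S c r -> coded p S c r' -> r = r'.
Proof.
move=> cr; elim: cr r' => {c r} [c n cn Sn|c A y c0 pA cy IH rky] r' cr'.
  by case: cr' cn => [c' n' -> _ [->]|c' A y -> ].
case: cr' c0 cy IH => [c' n -> //|c' A' y' _ pA' cy' _ _ cy IH].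
by apply: (eq_plim (filterI pA pA')) => m [Am A'm]; apply: IH (cy' m A'm).
Qed.

Lemma hull_embed p (S : set nat) n : S n -> hull p S (beta_embed n).
Proof. by move=> Sn; exists (fun=> Some n); exact: coded_nat. Qed.

Lemma hull_support p S r : hull p S r -> r S.
Proof.
move=> [c]; elim=> {c r} [c n _ Sn|c A y _ pA _ yS _] /=; first by move=> _ ->.
exact: filterS pA.
Qed.

Lemma hull_rk_le p S r : hull p S r -> free r -> rk_le p r.
Proof.
move=> [c [{}c n _ _|//]] fr.
by have /= := fr n n erefl; rewrite ltnn.
Qed.

Definition lim_closed (p : betaomega) (P : set betaomega) :=
  forall (A : set nat) y, p A -> (forall m, A m -> P (y m)) ->
    rk_le p (plim p y) -> P (plim p y).

Lemma hull_lim_closed p S : lim_closed p (hull p S).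
Proof.
move=> A y pA Py rky.
have ex m : exists c, A m -> coded p S c (y m).
  by have [/Py[c cy]|nA] := pselect (A m); [exists c|exists (fun=> None)].
have [c cP] := choice ex.
exists (fun s => if s is m :: t then c m t else None).
exact: coded_lim pA cP rky.
Qed.

(** Limits along [push g p] are limits along [p] of a reindexed sequence, and
for injective [g] the two ultrafilters are Rudin-Keisler equivalent, so they
have the same admissible limits. *)
Lemma push_lim_closed (p : betaomega) (P : set betaomega) g gi :
  cancel g gi -> lim_closed p P -> lim_closed (push g p) P.
Proof.
move=> gK Pp A y pA Py [h hy].
have e : plim (push g p) y = plim p (y \o g) by exact: betaomega_subP.
rewrite e; apply: (Pp (g @^-1` A)) => // [m|]; first exact: Py.
exists (gi \o h); apply/esym/betaomega_subP => B pB; rewrite -e.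
have : push g p (gi @^-1` B) by apply: filterS pB => m /=; rewrite gK.
by rewrite -{1}hy.
Qed.

(** Pairs of a map and a code are encoded as a single function on a countable
type. A principal ultrafilter is an image of any ultrafilter under a constant
map, so avoiding the images of the hull also makes [q] free. *)
Lemma exists_not_below p (S : set nat) n : S n ->
  exists2 q, free q & forall r, hull p S r -> ~ rk_le q r.
Proof.
move=> Sn.
have [|q qP] := @exists_avoiding (nat + seq nat)%type (option nat)
  (fun x r => exists2 r0, coded p S (fun s => x (inr s)) r0 &
     r = push (fun a => odflt 0 (x (inl a))) r0).
  by move=> x r r' [r0 c0 ->] [r1 c1 ->]; rewrite (coded_inj c0 c1).
have qN r h : hull p S r -> q <> push h r.
  move=> [c cr].
  by apply: (qP (fun z => match z with inl a => Some (h a) | inr s => c s end));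
    exists r.
exists q => [|r Pr [h hr]]; last exact: (qN r h).
apply: nonprincipal_free => k e; apply: (qN _ (fun=> k) (hull_embed p Sn)).
rewrite e; apply: betaomega_subP => B kB; change (forall j, j = n -> B k).
by move=> j _; apply: kB.
Qed.

(** * Cascades in subspaces *)

Lemma nbhs_set_type (X : set betaomega) (x : set_type X) (U : set (set_type X)) :
  nbhs x U ->
  exists2 B : set nat, val x B & forall z : set_type X, val z B -> U z.
Proof.
rewrite nbhsE => -[_ [[V oV <-] Vx] VU].
have : nbhs (val x) V by apply: open_nbhs_nbhs; split.
by move=> /nbhs_betaomega[B xB BV]; exists B => // z /BV/VU.
Qed.

(** The intermediate limits are in [P] by induction; the outermost one is either
equal to one of them or admissible. *)
Lemma rigid_cascade (X P : set betaomega) (p : betaomega) n (H M : set nat)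
    (f : {fset nat} -> set_type X) :
  P `<=` X -> lim_closed p P -> free p -> p H -> H `<=` M ->
  rigid p n H (val \o f) -> (forall s, subsets n H s -> P (val (f s))) ->
  exists x : set_type X,
    [/\ val x = itlim p n (val \o f), P (val x) & cascade_plimit p n M f x].
Proof.
move=> PX Pp fp; elim: n H M f => [|n IH] H M f pH HM rig Pf.
  by exists (f fset0); split=> //; apply: Pf; exact: subsets0.
case: rig => rig top.
have ex m : exists y : set_type X, H m ->
    [/\ val y = itlim p n (fun s => val (f (m |` s)%fset)), P (val y) &
      cascade_plimit p n (M `\` `I_m.+1) (fun s => f (m |` s)%fset) y].
  have [Hm|nH] := pselect (H m); last by exists (f fset0).
  have [|||s ms|y yP] := IH (above m H) (M `\` `I_m.+1)
    (fun s => f (m |` s)%fset).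
  - exact: filterI pH (fp m).
  - by move=> k [/HM Mk /= mk]; split=> //=; apply/negP; rewrite -leqNgt.
  - exact: rig.
  - by apply: Pf; exact: subsets_cons.
  - by exists y.
have [y yP] := choice ex.
have Plim : P (itlim p n.+1 (val \o f)).
  case: top => [pc|rkp].
    have [m [Hm <-]] := filter_ex (filterI pH pc).
    by have [e Py _] := yP m Hm; rewrite e in Py.
  apply: (Pp H) => // m Hm.
  by have [e Py _] := yP m Hm; rewrite e in Py.
have Xlim := PX _ Plim.
exists (SigSub (mem_set Xlim)); split=> //.
exists H, y; split=> // [m Hm|U /nbhs_set_type[B xB BU]].
  by have [] := yP m Hm.
apply: filterS (filterI pH xB) => m [Hm mB]; split=> //; apply: BU.
by have [-> _ _] := yP m Hm.
Qed.

Lemma unbounded_enum (H : set nat) : unbounded H -> exists g gi : nat -> nat,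
  [/\ cancel g gi, forall i, H (g i) & forall i, i <= g i].
Proof.
move=> uH; have ex k : exists m, H m /\ k < m by have [m] := uH k; exists m.
have [nxt nxtP] := choice ex.
pose g i := iter i.+1 nxt 0.
have gS i : g i < g i.+1 by exact: (nxtP _).2.
have gM : {homo g : i j / i < j} by apply: homo_ltn gS; exact: ltn_trans.
have ginj : injective g.
  by move=> i j e; case: (ltngtP i j) => // /gM; rewrite e ltnn.
have exi k : exists i, forall j, g j = k -> j = i.
  have [[i <-]|nk] := pselect (exists i, g i = k).
    by exists i => j /ginj.
  by exists 0 => j jk; case: nk; exists j.
have [gi giP] := choice exi.
exists g, gi; split=> [i|i|]; first by rewrite -(giP (g i) i).
  exact: (nxtP _).1.
by elim=> // i /leq_ltn_trans; apply; exact: gS.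
Qed.

(** [p] itself need not contain the rigid set [H], but its image under an
enumeration of [H] does. *)
Lemma hull_cascade (X P : set betaomega) (p : betaomega) n (M : set nat)
    (f : {fset nat} -> set_type X) :
  P `<=` X -> lim_closed p P -> free p -> unbounded M ->
  (forall s, subsets n M s -> P (val (f s))) ->
  exists2 q, free_ultrafilter q & exists x, cascade_plimit q n setT f x.
Proof.
move=> PX Pp fp uM Pf.
have [H [HM uH rig]] := exists_rigid n (val \o f) uM.
have [g [gi [gK Hg leg]]] := unbounded_enum uH.
have fq : free (push g p).
  move=> k; change (p (g @^-1` [set m | k < m])).
  by apply: filterS (fp k) => m /= km; exact: leq_trans km (leg m).
have qH : p (g @^-1` H) by exact: filterE.
have [s Hs|x [_ _ xc]] := rigid_cascade PX (push_lim_closed gK Pp) fq qH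
  (@subsetT _ H) (rig _ fq qH).
  exact: Pf (subsetsS HM Hs).
exists (push g p); first exact: free_free_ultrafilter.
by exists x.
Qed.

(** * The space *)

Lemma nbhs_val (X : set betaomega) (x : set_type X) (B : set nat) :
  val x B -> nbhs x [set z : set_type X | val z B].
Proof.
move=> xB.
have nb : nbhs (set_val x) (beta_clopen B) by apply/nbhs_betaomega; exists B.
exact: (@initial_continuous _ _ set_val x _ nb).
Qed.

(** Infinitely many [n] is rendered as arbitrarily large [n], the form from which
freeness of the coordinates of an accumulation point is read off. *)
Lemma square_accumulation (X : set betaomega) (u v : nat -> set_type X) :
  countably_compact (set_type X * set_type X)%type ->
  exists x y : set_type X, forall (A B : set nat) k, val x A -> val y B ->
    exists2 n, k < n & val (u n) A /\ val (v n) B.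
Proof.
move=> /(_ (fun n => (u n, v n)))[[x y] acc]; exists x, y => A B k xA yB.
pose U := [set z : set_type X * set_type X | val z.1 A /\ val z.2 B].
have xyU : nbhs (x, y) U.
  exists ([set z : set_type X | val z A], [set z : set_type X | val z B]).
    by split; exact: nbhs_val.
  by case.
have [n [Un /negP]] :=
  infinite_setN0 (infinite_setD (acc U xyU) (finite_II k.+1)).
by rewrite -leqNgt => kn; exists n.
Qed.

Theorem corollary4p6 :
  exists X : set betaomega,
    [/\ range beta_embed `<=` X,
        ~ countably_compact (set_type X * set_type X)%type
      & forall n : nat, cascade_countably_compact n (set_type X)].
Proof.
have [p fp] := exists_free.
pose E : set nat := [set n | ~~ odd n].
have [q fq qP] := @exists_not_below p E 0 isT.
pose P := hull p E; pose Q := hull q (~` E).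
have XE n : (P `|` Q) (beta_embed n).
  have [En|nEn] := pselect (E n); [left|right]; exact: hull_embed.
exists (P `|` Q); split=> [_ [n _ <-] //|cc|n f].
- pose emb n : set_type (P `|` Q) := SigSub (mem_set (XE n)).
  have [r [r' acc]] := square_accumulation
    (fun n => emb n.*2) (fun n => emb n.*2.+1) cc.
  have meet (B B' : set nat) k : val r B -> val r' B' ->
      exists2 n, k < n & B n.*2 /\ B' n.*2.+1.
    move=> rB r'B'; have [n kn [nB nB']] := acc B B' k rB r'B'.
    by exists n => //; split; [exact: nB|exact: nB'].
  (* [r] is concentrated on the even numbers, and so not in [Q]. *)
  have rE : val r E.
    apply: contrapT => /ultraC rE; have [n _ [nE _]] := meet _ _ 0 rE filterT.
    by apply: nE; rewrite /E /= odd_double.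
  have r'E : val r' (~` E).
    apply/ultraC => r'E; have [n _ [_]] := meet _ _ 0 filterT r'E.
    by rewrite /E /= odd_double.
  have fr : free (val r).
    move=> k; apply: contrapT => /ultraC nk.
    have [n kn [nkn _]] := meet _ _ k nk filterT.
    by apply: nkn; rewrite /= -addnn ltn_addr.
  (* If [B] is in [r'] and its successor preimage is not in [r], some
     [n] has [2n+1] in [B] and [2n] outside that preimage. *)
  have er : val r' = push succn (val r).
    apply: betaomega_subP => B r'B; apply: contrapT => /(ultraC (push _ _)) rB.
    by have [n _ [nB /nB]] := meet _ _ 0 rB r'B.
  have Pr : P (val r).
    have [//|/hull_support/ultraC] := set_valP r; exact.
  have Qr : Q (val r').
    by have [/hull_support|//] := set_valP r'; move/ultraC: r'E.
  apply: (qP _ Pr); have [|h <-] := hull_rk_le Qr.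
    by move=> k; rewrite er; apply: filterS (fr k) => m /= /leqW.
  by exists (h \o succn); rewrite er; exact: betaomega_subP.
- have [PM|QM] : for_most p n (fun s => P (val (f s))) \/
      for_most p n (fun s => Q (val (f s))).
    have [?|/for_most_not nP] := pselect (for_most p n (fun s => P (val (f s)))).
      by left.
    right; apply: for_most_eq nP => s; split=> [nPs|Qs Ps].
      by have [] := set_valP (f s).
    have [k [Ek]] := filter_ex (filterI (hull_support Ps) (hull_support Qs)).
    exact.
  + have [M [uM _ PfM _]] := ultra_ramsey2 fp filterT PM PM.
    apply: (hull_cascade _ (@hull_lim_closed p E) fp uM PfM).
    by move=> r Pr; left.
  + have [M [uM _ QfM _]] := ultra_ramsey2 fp filterT QM QM.
    apply: (hull_cascade _ (@hull_lim_closed q (~` E)) fq uM QfM).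
    by move=> r Qr; right.
Qed.
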